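(* Let $a<b$ be real numbers and let $f:[a,b]\to\mathbb{R}$ be a differentiable function whose derivative $f':[a,b]\to\mathbb{R}$ is an absolutely continuous function such that $f''\in L_1(a,b)$ and there exist real numbers $\gamma_2,\Gamma_2$ such that $\gamma_2\le f''(t)\le\Gamma_2$ for $t\in[a,b]$. Let $S_1=(f'(b)-f'(a))/(b-a)$. Then $$|Q(f;a,b)-P(f;a,b)|\le\frac{\Gamma_2-\gamma_2}{2}\left(\frac{5}{96}\sqrt6-\frac{29}{432}\sqrt3\right)(b-a)^3,$$ $$|Q(f;a,b)-P(f;a,b)|\le\left(\frac1{12}-\frac{\sqrt2}{32}\right)(S_1-\gamma_2)(b-a)^3,$$ $$|Q(f;a,b)-P(f;a,b)|\le\left(\frac1{12}-\frac{\sqrt2}{32}\right)(\Gamma_2-S_1)(b-a)^3.$$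
   Context: For $f$ on $[a,b]$, $$Q(f;a,b)=\int_a^b f(t)\,dt-\left[\frac{\sqrt2}{8}f(a)+\left(1-\frac{\sqrt2}{4}\right)f\left(\frac{a+b}{2}\right)+\frac{\sqrt2}{8}f(b)\right](b-a),$$ $$P(f;a,b)=\frac{(b-a)^2}{96}\left(4-3\sqrt2\right)\left[f'(b)-f'(a)\right].$$ The derivative $f''$ of the absolutely continuous function $f'$ exists almost everywhere, and the bounds $\gamma_2\le f''(t)\le\Gamma_2$ are understood for almost every $t$. *)

(* Defs.v *)
From HB Require Import structures.
From mathcomp Require Export all_boot all_order all_algebra.
From mathcomp Require Export all_classical all_reals all_analysis.
Set Implicit Arguments.
Unset Strict Implicit.
Unset Printing Implicit Defensive.
Import Order.TTheory GRing.Theory Num.Theory.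
Import numFieldNormedType.Exports.
Local Open Scope classical_set_scope.
Local Open Scope ring_scope.

Section defs.
Context {R : realType}.
Implicit Types (a b x : R) (f : R -> R).

(* A function on [a, b] is represented by a total f : R -> R of which only the
   values on [a, b] are used. Its derivative at x in [a, b] is the limit of
   (f y - f x) / (y - x) as y -> x with y in [a, b] and y != x: the two-sided
   derivative when a < x < b, the one-sided one at the endpoints. *)
Definition diff_quot f x y : R := (f y - f x) / (y - x).

Definition derivable_seg a b f x : Prop :=
  cvg (diff_quot f x y @[y --> within `[a, b] (x^')]).

(* Where the limit does not exist the value is the default point of R, 0. *)
Definition derive_seg a b f x : R :=
  lim (diff_quot f x y @[y --> within `[a, b] (x^')]).

Definition abs_continuous_seg a b f : Prop :=
  forall e : R, 0 < e -> exists2 d : R, 0 < d &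
    forall (n : nat) (u v : 'I_n -> R),
      (forall i, [/\ a <= u i, u i < v i & v i <= b]) ->
      trivIset [set: 'I_n] (fun i => `]u i, v i[%classic) ->
      \sum_(i < n) (v i - u i) < d ->
      \sum_(i < n) `|f (v i) - f (u i)| < e.

Definition Q f a b : R :=
  (\int[lebesgue_measure]_(t in `[a, b]) f t)%R
  - (Num.sqrt 2 / 8 * f a + (1 - Num.sqrt 2 / 4) * f ((a + b) / 2)
     + Num.sqrt 2 / 8 * f b) * (b - a).

Definition P f a b : R :=
  (b - a) ^+ 2 / 96 * (4 - 3 * Num.sqrt 2)
  * (derive_seg a b f b - derive_seg a b f a).

End defs.

(* Main.v *)
From HB Require Import structures.
Require Import Defs.
From mathcomp Require Import ring lra measurable_realfun.
Set Implicit Arguments.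
Unset Strict Implicit.
Unset Printing Implicit Defensive.
Import Order.TTheory GRing.Theory Num.Theory.
Import numFieldNormedType.Exports.
Local Open Scope classical_set_scope.
Local Open Scope ring_scope.

(** Let m be the midpoint of [a, b] and L = b - a. The number Q - P is the
    integral of K f'', where the kernel K is, on each half of the segment, a
    parabola ((t - s)^2 - d^2) / 2, with s = a + c on [a, m], s = b - c on
    [m, b], c = L sqrt(2) / 8 and d = L sqrt(3) (3 sqrt(2) - 2) / 24. The
    constant d is such that K has mean zero on each half: subtracting the
    correction P from Q amounts to subtracting its mean from the kernel of Q.
    Consequently f'' may be replaced by f'' - gamma2 or Gamma2 - f'', which are
    nonnegative. The last two estimates follow from
    max |K| = K(m) = (1/12 - sqrt(2)/32) L^2, since f'' - gamma2 has mean
    S1 - gamma2. The first one follows from |f'' - (gamma2 + Gamma2)/2| <=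
    (Gamma2 - gamma2)/2 and from the integral of |K|, which is
    4 (2 d^3 / 3) = 8 d^3 / 3.

    The integral of K f'' is replaced here by an expression in f, f' and the
    kernel obtained by integration by parts (quadrature_parts). It is then
    enough to know that the difference quotients of f' lie between gamma2 and
    Gamma2, and sign considerations on derivatives give the bounds on each
    half (parts_bound_above_slope, parts_bound_slopes).

    The bound on difference quotients (abs_continuous_slope_bounds) is where
    absolute continuity matters: f' must be the integral of f''. To prove it,
    f' is written as the difference of two nondecreasing absolutely continuous
    functions, its variation and the rest (abs_continuousR_tv_sum,
    tv_fromB_nondecreasing). The Stieltjes measure of such a function is
    absolutely continuous (abs_continuousR_dominates), so it has a
    Radon-Nikodym density, which by Lebesgue differentiation is almost
    everywhere the derivative (nondecreasing_density). *)

(** * Absolute continuity and total variation *)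

Section AbsoluteContinuity.
Context {R : realType}.
Implicit Types (a b x y : R) (g : R -> R) (p q : R * R) (s t : seq (R * R)).

(** Disjointness of the open intervals ]p.1, p.2[ and ]q.1, q.2[, written so that
    it also holds, as it should, when one of them is empty; it is then stable
    under monotone maps of the endpoints. *)
Definition apart p q :=
  [|| p.2 <= p.1, p.2 <= q.1, q.2 <= p.1 | q.2 <= q.1].

Definition forward p := p.1 <= p.2.

Definition total_length s := \sum_(p <- s) (p.2 - p.1).

(** Absolute continuity on the whole line. Lists of intervals, possibly empty
    ones, take the place of indexed families because the proofs below
    concatenate and subdivide such families. *)
Definition abs_continuousR g := forall e, 0 < e -> exists2 d, 0 < d &
  forall s, all forward s -> pairwise apart s -> total_length s < d ->
    \sum_(p <- s) `|g p.2 - g p.1| <= e.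

Lemma total_length_ge0 s : all forward s -> 0 <= total_length s.
Proof.
move=> /allP sf; rewrite /total_length big_seq sumr_ge0// => p /sf.
by rewrite subr_ge0.
Qed.

Lemma total_length_cons p s :
  total_length (p :: s) = p.2 - p.1 + total_length s.
Proof. by rewrite /total_length big_cons. Qed.

Lemma apart_sub p p' q : p.1 <= p'.1 -> p'.2 <= p.2 -> apart p q -> apart p' q.
Proof.
by move=> h1 h2 /or4P[] h; apply/or4P;
  [apply: Or41|apply: Or42|apply: Or43|apply: Or44]; lra.
Qed.

Definition clamp a b x := Num.min b (Num.max a x).

Lemma clamp_in a b x : a <= b -> a <= clamp a b x <= b.
Proof. by move=> ab; rewrite /clamp le_min ab le_max lexx/= ge_min lexx. Qed.

Lemma clamp_id a b x : a <= x <= b -> clamp a b x = x.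
Proof. by move=> /andP[ax xb]; rewrite /clamp (max_idPr _)// (min_idPr _). Qed.

Lemma clamp_homo a b : {homo clamp a b : x y / x <= y}.
Proof.
move=> x y xy; rewrite /clamp le_min ge_min lexx/= ge_min; apply/orP; right.
by rewrite ge_max !le_max lexx/= xy orbT.
Qed.

Lemma clamp_lip a b x y : a <= b -> x <= y -> clamp a b y - clamp a b x <= y - x.
Proof.
move=> ab xy; rewrite /clamp.
have [|] := leP a x; have [|] := leP a y => *;
 repeat match goal with |- context [Num.min ?u ?v] => have [|] := leP u v => ? end; lra.
Qed.

(** Extending g by the constants g a and g b keeps absolute continuity, since
    clamping is monotone and does not lengthen intervals; working on the whole
    line then removes every side condition at a and b. *)
Lemma clamp_abs_continuous a b g : a <= b ->
  abs_continuous_seg a b g -> abs_continuousR (g \o clamp a b).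
Proof.
move=> ab acg e e0; have [d d0 H] := acg e e0; exists d => // s sf sa sd.
(* Clamped intervals may become empty: these contribute nothing, and are
   dropped because the segment version only speaks of nonempty intervals. *)
pose s0 := [seq (clamp a b p.1, clamp a b p.2) | p <- s].
pose s' := [seq p <- s0 | p.1 < p.2].
have s'a : pairwise apart s'.
  apply: (subseq_pairwise (filter_subseq _ _)); rewrite pairwise_map.
  apply: sub_pairwise sa => p q /or4P[] h; apply/or4P;
    [apply: Or41|apply: Or42|apply: Or43|apply: Or44]; exact: clamp_homo.
pose N := size s'; pose F (i : 'I_N) := nth (0, 0) s' i.
have sF i : F i \in s' by rewrite mem_nth.
have sumF (G : R * R -> R) : \sum_(i < N) G (F i) = \sum_(p <- s') G p.
  by rewrite (big_nth (0, 0)) big_mkord.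
apply: ltW; apply: le_lt_trans (H N (fst \o F) (snd \o F) _ _ _).
- rewrite (sumF (fun p => `|g p.2 - g p.1|)) big_filter big_map [leRHS]big_mkcond/=.
  rewrite big_seq [leRHS]big_seq; apply: ler_sum => p ps; case: ifPn => //=.
  have := clamp_homo a b (allP sf _ ps); rewrite le_eqVlt => /orP[/eqP->|->//].
  by rewrite subrr normr0.
- move=> i; move: (sF i); rewrite /= mem_filter => /andP[lt /mapP[p ps E]].
  split=> //; rewrite E/=; first by case/andP: (clamp_in p.1 ab).
  by case/andP: (clamp_in p.2 ab).
- have key (i j : 'I_N) : (i < j)%N ->
      `](F i).1, (F i).2[%classic `&` `](F j).1, (F j).2[%classic = set0.
    move=> ij; have := (pairwiseP (0, 0) s'a) i j (ltn_ord i) (ltn_ord j) ij.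
    rewrite -subset0 => /or4P h z /= [].
    rewrite !in_itv /= => /andP[z1 z2] /andP[z3 z4].
    by rewrite -/(F i) -/(F j) in h; case: h => h; lra.
  move=> i j _ _ [z [zi zj]]; apply/eqP; apply: contraT => ne.
  have := ne; rewrite neq_ltn => /orP[/key E|/key E].
    have : set0 z by rewrite -E; split.
    by [].
  have : set0 z by rewrite -E; split.
  by [].
- rewrite (sumF (fun p => p.2 - p.1)); apply: le_lt_trans sd.
  rewrite /total_length big_filter big_map big_mkcond/=.
  rewrite big_seq [leRHS]big_seq; apply: ler_sum => p ps.
  have pf := allP sf _ ps; have := clamp_lip ab pf.
  by case: ifP => // _ _; rewrite subr_ge0.
Qed.

Lemma abs_continuousRB g h : abs_continuousR g -> abs_continuousR h ->
  abs_continuousR (fun x => g x - h x).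
Proof.
move=> acg ach e e0; have e2 : 0 < e / 2 by lra.
have [d1 d10 H1] := acg _ e2; have [d2 d20 H2] := ach _ e2.
exists (Num.min d1 d2) => [|s sf sa]; first by rewrite lt_min d10.
rewrite lt_min => /andP[/(H1 _ sf sa) h1 /(H2 _ sf sa) h2].
rewrite (splitr e); apply: le_trans (lerD h1 h2).
rewrite -big_split/=; apply: ler_sum => p _.
rewrite [X in `|X|](_ : _ = (g p.2 - g p.1) - (h p.2 - h p.1)); last by lra.
exact: ler_normB.
Qed.

Fixpoint steps x (s : seq R) : seq (R * R) :=
  if s is y :: s' then (x, y) :: steps y s' else [::].

Lemma steps_in x (s : seq R) p : path <%O x s -> p \in steps x s ->
  [/\ x <= p.1, p.1 <= p.2 & p.2 <= last x s].
Proof.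
elim: s x => //= y s IH x /andP[xy ys]; rewrite inE => /predU1P[->/=|].
  split => //; first exact: ltW.
  by elim: s y ys {IH xy} => //= z s IH y /andP[/ltW yz /IH]; exact: le_trans.
by move=> /(IH _ ys)[h1 h2 h3]; split => //; exact: le_trans (ltW xy) h1.
Qed.

Lemma steps_apart x (s : seq R) : path <%O x s -> pairwise apart (steps x s).
Proof.
elim: s x => //= y s IH x /andP[xy ys]; rewrite IH// andbT.
apply/allP => p /(steps_in ys)[h _ _]; apply/or4P; exact: Or42.
Qed.

Lemma steps_length x (s : seq R) : total_length (steps x s) = last x s - x.
Proof.
rewrite /total_length; elim: s x => /= [x|y s IH x].
  by rewrite big_nil subrr.
by rewrite big_cons IH /=; lra.
Qed.

Lemma steps_variation x y g (s : seq R) : itv_partition x y s ->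
  \sum_(p <- steps x s) `|g p.2 - g p.1| = variation x y g s.
Proof.
move=> xys; rewrite (variation_zip _ xys); elim: s x {xys} => /= [x|z s IH x].
  by rewrite !big_nil.
by rewrite !big_cons IH.
Qed.

(** The modulus of absolute continuity of g controls total variations too:
    each interval of t can be subdivided at will without changing the total
    length. The list s holds the subdivided intervals, so that the induction
    on t replaces one total variation at a time by one of its partition sums
    and takes the supremum. *)
Lemma abs_continuousR_tv_sum g (e d : R) :
  (forall s, all forward s -> pairwise apart s -> total_length s < d ->
    \sum_(p <- s) `|g p.2 - g p.1| <= e) ->
  forall t s, all forward (t ++ s) -> pairwise apart (t ++ s) ->
    total_length (t ++ s) < d ->
  (\sum_(p <- t) total_variation p.1 p.2 g +
     (\sum_(p <- s) `|g p.2 - g p.1|)%:E <= e%:E)%E.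
Proof.
move=> H; elim => [|[x y] t IH] s.
  by rewrite big_nil add0e; exact: H.
rewrite /= => /andP[xy tsf] /andP[xya tsa]; rewrite total_length_cons /= => L.
rewrite /forward/= in xy.
rewrite big_cons /= -addeA; set X := (_ + (\sum_(p <- s) _)%:E)%E.
have ts0 := total_length_ge0 tsf.
have Xe : (X <= e%:E)%E by apply: IH => //; lra.
have X0 : (0 <= X)%E.
  rewrite adde_ge0 ?lee_fin ?sumr_ge0// big_seq sume_ge0// => p pt.
  apply: total_variation_ge0; apply: (allP tsf); by rewrite mem_cat pt.
have Xfin : X \is a fin_num by rewrite ge0_fin_numE// (le_lt_trans Xe) ?ltry.
rewrite -leeBrDr//; apply: ge_ereal_sup => _ [_ [u uxy <-] <-].
rewrite leeBrDr// -(steps_variation g uxy) /X addeCA -EFinD -big_cat/=.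
have [up /eqP ul] := uxy.
apply: IH.
- rewrite all_cat (all_cat _ (steps x u)).
  move: tsf; rewrite all_cat => /andP[-> ->]; rewrite andbT/=.
  by apply/allP => p /(steps_in up)[].
- have sub p : p \in steps x u -> all (apart p) (t ++ s).
    move=> /(steps_in up)[h1 _ h2]; apply/allP => q /(allP xya).
    by apply: apart_sub => //=; rewrite -ul.
  move: tsa; rewrite !pairwise_cat => /and3P[ts tp sp].
  rewrite steps_apart// sp tp !andbT/=; apply/andP; split.
    rewrite allrel_catr ts andbT; apply/allrelP => p q pt qu.
    have /allP/(_ p) := sub q qu; rewrite mem_cat pt => /(_ erefl).
    by rewrite /apart => /or4P[] ->; rewrite ?orbT.
  apply/allrelP => p q pu qs.
  by have /allP/(_ q) := sub p pu; rewrite mem_cat qs orbT => /(_ erefl).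
- move: L; rewrite /total_length !big_cat /= -!/(total_length _) steps_length ul.
  lra.
Qed.

End AbsoluteContinuity.

(** * Jordan decomposition of an absolutely continuous function *)

Section Jordan.
Context {R : realType}.
Implicit Types (a b x y : R) (g : R -> R).

(** On intervals shorter than the modulus for e = 1 the variation is at most
    1; a bounded interval is a finite union of intervals of half that length. *)
Lemma abs_continuousR_tv_fin g x y : abs_continuousR g -> x <= y ->
  total_variation x y g \is a fin_num.
Proof.
move=> acg; have [d d0 H] := acg 1 ltr01.
have key := abs_continuousR_tv_sum H.
suff: forall n : nat, forall x y, x <= y -> y - x < n%:R * (d / 2) ->
    total_variation x y g \is a fin_num.
  move=> suf xy; apply: (suf (Num.bound ((y - x) / (d / 2)))) => //.
  rewrite -ltr_pdivrMr ?divr_gt0//; apply: archi_boundP.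
  by rewrite divr_ge0//; lra.
elim => [x' y' xy|n IH x' y' xy h]; first by rewrite mul0r; lra.
have [sm|lg] := ltP (y' - x') d.
  rewrite ge0_fin_numE ?total_variation_ge0// (@le_lt_trans _ _ 1%:E)// ?ltry//.
  have := key [:: (x', y')] [::]; rewrite big_seq1 big_nil adde0; apply => //=.
    by rewrite andbT.
  by rewrite /total_length big_seq1.
rewrite (@total_variationD _ x' y' (x' + d / 2)); [|lra|lra].
rewrite fin_numD; apply/andP; split; last first.
  by apply: IH; [lra|rewrite -natr1 in h; lra].
rewrite ge0_fin_numE ?total_variation_ge0//; last lra.
rewrite (@le_lt_trans _ _ 1%:E)// ?ltry//.
have := key [:: (x', x' + d / 2)] [::]; rewrite big_seq1 big_nil adde0; apply => //=.
  by rewrite andbT /forward/=; lra.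
by rewrite /total_length big_seq1/=; lra.
Qed.

(** The maximum makes the function constant before a, hence monotone on the
    whole line, as the distribution function of a measure must be. *)
Definition tv_from a g x := fine (total_variation a (Num.max a x) g).

Lemma tv_from_itv a g x y : abs_continuousR g -> a <= x -> x <= y ->
  tv_from a g y - tv_from a g x = fine (total_variation x y g).
Proof.
move=> acg ax xy; rewrite /tv_from !(max_idPr _)// ?(le_trans ax)//.
rewrite (total_variationD _ ax xy) fineD ?abs_continuousR_tv_fin//.
by rewrite addrC addKr.
Qed.

Lemma tv_from_max a g x : tv_from a g (Num.max a x) = tv_from a g x.
Proof. by rewrite /tv_from maxA maxxx. Qed.

Lemma tv_from_nondecreasing a g : abs_continuousR g ->
  {homo tv_from a g : x y / x <= y}.
Proof.
move=> acg x y xy; rewrite -tv_from_max -(tv_from_max _ _ y) -subr_ge0.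
have mxy : Num.max a x <= Num.max a y.
  by rewrite ge_max !le_max lexx/= xy orbT.
have amx : a <= Num.max a x by rewrite le_max lexx.
by rewrite tv_from_itv// fine_ge0// total_variation_ge0.
Qed.

Lemma tv_from_le_tv a g x y : abs_continuousR g -> x <= y ->
  tv_from a g y - tv_from a g x <= fine (total_variation x y g).
Proof.
move=> acg xy; have [ax|xa] := leP a x; first by rewrite tv_from_itv.
have [ay|ya] := leP a y; last first.
  rewrite /tv_from (max_idPl (ltW xa)) (max_idPl (ltW ya)) subrr.
  by rewrite fine_ge0// total_variation_ge0.
have xla := ltW xa.
rewrite -(tv_from_max _ _ x) (max_idPl xla) tv_from_itv//.
rewrite (total_variationD _ xla ay) fineD ?abs_continuousR_tv_fin//.
by rewrite lerDr fine_ge0// total_variation_ge0.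
Qed.

Lemma tv_from_abs_continuous a g : abs_continuousR g ->
  abs_continuousR (tv_from a g).
Proof.
move=> acg e e0; have [d d0 H] := acg e e0; exists d => // s sf sa sd.
have := abs_continuousR_tv_sum H (s := [::]) (t := s).
rewrite cats0 big_nil adde0 => /(_ sf sa sd).
rewrite -lee_fin; apply: le_trans; rewrite -sumEFin big_seq [leRHS]big_seq.
apply: lee_sum => p /(allP sf) pf.
rewrite ger0_norm ?subr_ge0 ?tv_from_nondecreasing//.
rewrite -[leRHS]fineK ?abs_continuousR_tv_fin// lee_fin.
exact: tv_from_le_tv.
Qed.

(** Jordan decomposition: g is the difference of tv_from a g and of this
    function, and both are nondecreasing and absolutely continuous. *)
Lemma tv_fromB_nondecreasing a g : abs_continuousR g ->
  (forall x, g (Num.max a x) = g x) ->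
  {homo (fun x => tv_from a g x - g x) : x y / x <= y}.
Proof.
move=> acg gmax x y xy.
rewrite -tv_from_max -(tv_from_max _ _ y) -(gmax x) -(gmax y).
have mxy : Num.max a x <= Num.max a y.
  by rewrite ge_max !le_max lexx/= xy orbT.
have amx : a <= Num.max a x by rewrite le_max lexx.
move: mxy amx; set u := Num.max a x; set v := Num.max a y => uv au.
have := total_variation_ge g uv.
rewrite -[leRHS]fineK ?abs_continuousR_tv_fin// lee_fin -(tv_from_itv acg au uv).
have := ler_norm (g v - g u); lra.
Qed.

Lemma abs_continuousR_continuous g : abs_continuousR g -> continuous g.
Proof.
move=> acg x; apply/cvgrPdist_le => e e0; have [d d0 H] := acg e e0.
near=> y.
have xyd : `|x - y| < d.
  by near: y; apply: cvgr_dist_lt => //; exact: cvg_id.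
have [xy|yx] := leP x y.
  have := H [:: (x, y)]; rewrite /total_length !big_seq1/= distrC; apply => //.
    by rewrite andbT.
  by move: xyd; rewrite ler0_norm; lra.
have := H [:: (y, x)]; rewrite /total_length !big_seq1/=; apply => //.
  by rewrite /forward/= ltW.
by move: xyd; rewrite gtr0_norm; lra.
Unshelve. all: by end_near. Qed.

End Jordan.

(** * Absolutely continuous Stieltjes measures *)

Section Density.
Context {R : realType}.
Implicit Types (a b x y : R) (g : R -> R).
Local Notation mu := (@lebesgue_measure R).

Lemma stieltjes_itv_oc (v : cumulative R R) x y : x <= y ->
  lebesgue_stieltjes_measure v `]x, y]%classic = (v y - v x)%:E.
Proof.
move=> xy; rewrite /lebesgue_stieltjes_measure /measure_extension measurable_mu_extE/=.
  by rewrite wlength_itv_bnd.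
exact: is_ocitv.
Qed.

Lemma open_itv_bounded (I : set R) : open I -> is_interval I ->
  (mu I < +oo)%E -> exists p : R * R, p.1 <= p.2 /\ I = `]p.1, p.2[%classic.
Proof.
move=> oI iI.
have [->|/set0P I0] := eqVneq I set0.
  by exists (0, 0); rewrite lexx set_itvoo0.
have IE : I = [set` Rhull I] by rewrite RhullK// inE.
have Ii : I = I° by apply/esym/interior_id.
move: IE; case: (Rhull I) => [l r] IE; rewrite {1}IE lebesgue_measure_itv /=.
case: l IE => [? l|[]] IE; case: r IE => [? r|[]] IE; rewrite ?ltry ?ltNyr //= => _.
- rewrite IE interior_itv in Ii; exists (l, r); split => //=; rewrite ?{1}IE//.
  by case: I0 => x; rewrite IE Ii /= in_itv/= => /andP[/lt_trans h /h /ltW].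
all: by case: I0 => x; rewrite IE/= in_itv /= ?andbF.
Qed.

Lemma disjoint_itv_apart (p q : R * R) :
  `]p.1, p.2[%classic `&` `]q.1, q.2[%classic = set0 -> apart p q.
Proof.
move=> pq0; apply: contraT; rewrite /apart !negb_or -!ltNge.
move=> /and4P[p12 q1p2 p1q2 q12].
suff: (`]p.1, p.2[%classic `&` `]q.1, q.2[%classic)
    ((Num.max p.1 q.1 + Num.min p.2 q.2) / 2) by rewrite pq0.
have : Num.max p.1 q.1 < Num.min p.2 q.2.
  by rewrite gt_max !lt_min p12 q1p2 p1q2 q12.
have : p.1 <= Num.max p.1 q.1 by rewrite le_max lexx.
have : q.1 <= Num.max p.1 q.1 by rewrite le_max lexx orbT.
have : Num.min p.2 q.2 <= p.2 by rewrite ge_min lexx.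
have : Num.min p.2 q.2 <= q.2 by rewrite ge_min lexx orbT.
move=> *; split; rewrite /= in_itv /=; apply/andP; split; lra.
Qed.

Lemma pairwise_iota (r : rel nat) m n :
  (forall i j, (i < j)%N -> r i j) -> pairwise r (iota m n).
Proof.
move=> rlt; apply: (@sub_pairwise _ ltn); first by move=> i j; exact: rlt.
by rewrite -(sorted_pairwise ltn_trans) iota_ltn_sorted.
Qed.

(** An open set is a countable disjoint union of open intervals; the modulus
    bounds the finite partial sums of the Stieltjes masses of these
    intervals, hence the mass of the open set. *)
Lemma stieltjes_open_le (v : cumulative R R) (e : R) : abs_continuousR v -> 0 < e ->
  exists2 d, 0 < d & forall U : set R, open U -> (mu U < d%:E)%E ->
    (lebesgue_stieltjes_measure v U <= e%:E)%E.
Proof.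
move=> acv e0; have [d d0 H] := acv e e0; exists d => // U oU Ud.
pose I := open_disjoint_itv oU.
have UI : U = \bigcup_k I k := open_disjoint_itv_bigcup oU.
have mI k : measurable (I k).
  by apply: open_measurable; exact: open_disjoint_itv_open.
have tI : trivIset setT I := @open_disjoint_itv_trivIset _ _ oU.
have muU : (mu U = \sum_(k <oo) mu (I k))%E.
  by rewrite UI measure_semi_bigcup//; rewrite -UI; exact: open_measurable.
have finI k : (mu (I k) < +oo)%E.
  apply: (@le_lt_trans _ _ (mu U)); last exact: lt_trans Ud (ltry _).
  apply: le_measure; rewrite ?inE; [exact: mI|exact: open_measurable|].
  by rewrite UI; exact: bigcup_sup.
(* The endpoints of the components; an empty component gets p.1 = p.2. *)
have /choice[p Hp] : forall k, exists p : R * R,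
    p.1 <= p.2 /\ I k = `]p.1, p.2[%classic.
  move=> k; apply: open_itv_bounded => //; first exact: open_disjoint_itv_open.
  exact: open_disjoint_itv_is_interval.
rewrite UI measure_semi_bigcup//; last by rewrite -UI; exact: open_measurable.
apply: lime_le; first by apply: is_cvg_nneseries.
near=> n.
apply: (@le_trans _ _ (\sum_(0 <= k < n) `|v (p k).2 - v (p k).1|%:E)%E).
  apply: lee_sum => k _; have [pk Ik] := Hp k.
  rewrite [leRHS](_ : _ = lebesgue_stieltjes_measure v `](p k).1, (p k).2]%classic).
    by apply: le_measure; rewrite ?inE ?Ik//; exact: subset_itv_oo_oc.
  rewrite stieltjes_itv_oc// ger0_norm// subr_ge0.
  exact: cumulative_is_nondecreasing.
rewrite sumEFin lee_fin.
have := H [seq p k | k <- iota 0 n].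
rewrite /total_length !big_map.
rewrite /index_iota subn0; apply.
- by apply/allP => _ /mapP[k _ ->]; rewrite /forward; case: (Hp k).
- rewrite pairwise_map; apply: pairwise_iota => i j ij /=.
  apply: disjoint_itv_apart; have [_ <-] := Hp i; have [_ <-] := Hp j.
  move/trivIsetP : tI; apply => //; by rewrite ltn_eqF.
- rewrite -lte_fin; apply: le_lt_trans Ud; rewrite muU -sumEFin.
  apply: le_trans (nneseries_lim_ge n _) => //.
  rewrite /index_iota subn0; apply: lee_sum => k _.
  have [pk ->] := Hp k; rewrite lebesgue_measure_itv/= lte_fin.
  case: ltP => // p21; rewrite lee_fin; lra.
Unshelve. all: by end_near. Qed.

(** A Lebesgue null set lies in open sets of arbitrarily small length, whose
    Stieltjes masses are arbitrarily small. *)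
Lemma abs_continuousR_dominates (v : cumulative R R) : abs_continuousR v ->
  lebesgue_stieltjes_measure v `<< mu.
Proof.
move=> acv; apply/null_content_dominatesP => A mA muA0.
apply/eqP; rewrite eq_le measure_ge0 andbT; apply/lee_addgt0Pr => e e0.
rewrite add0e; have [d d0 H] := stieltjes_open_le acv e0.
have [|U [oU AU UAd]] := @lebesgue_regularity_outer _ A d mA _ d0.
  by rewrite muA0.
apply: (@le_trans _ _ (lebesgue_stieltjes_measure v U)).
  by rewrite le_measure ?inE//; exact: open_measurable.
apply: H => //; rewrite -(setDUK AU); apply: le_lt_trans (measureU2 _ _ _) _ => //.
  by apply: measurableD => //; exact: open_measurable.
by rewrite muA0 add0e.
Qed.

End Density.

(** * Densities of monotone functions *)

Section DensityOfMonotone.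
Context {R : realType}.
Implicit Types (a b x y : R) (g : R -> R).
Local Notation mu := (@lebesgue_measure R).

Definition has_density a b (v h : R -> R) := [/\ mu.-integrable setT (EFin \o h),
  forall x, a <= x <= b -> v x - v a = (\int[mu]_(t in `]a, x]) h t)%R &
  {ae mu, forall x, a < x < b -> derivable v x 1 /\ v^`()%classic x = h x}].

(** The density is the Radon-Nikodym derivative of the Stieltjes measure,
    restricted to ]a, b] to make it finite; the Lebesgue differentiation
    theorem identifies it almost everywhere with the derivative of v. *)
Lemma nondecreasing_density a b (v : R -> R) : a <= b -> abs_continuousR v ->
  {homo v : x y / x <= y} -> exists h, has_density a b v h.
Proof.
move=> ab acv ndv.
have rcv : right_continuous v.
  by apply: right_continuousW; exact: abs_continuousR_continuous.
pose V : cumulative R R :=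
  HB.pack_for (cumulative R R) v (isCumulative.Build R _ R v ndv rcv).
have mab : measurable (`]a, b]%classic : set (measurableTypeR R)).
  exact: measurable_itv.
have Vfin : (lebesgue_stieltjes_measure V `]a, b]%classic < +oo)%E.
  by rewrite stieltjes_itv_oc// ltry.
pose nu : {finite_measure set _ -> \bar R} := mfrestr mab Vfin.
have numu : nu `<< mu.
  apply/null_content_dominatesP => A mA muA0.
  have /null_content_dominatesP := abs_continuousR_dominates (v := V) acv.
  apply; first exact: measurableI.
  apply/eqP; rewrite eq_le measure_ge0 andbT -muA0; apply: le_measure; rewrite ?inE//.
  exact: measurableI.
have [h [h0 hfin hint hE]] := radon_nikodym_sigma_finite numu.
have EFinh : EFin \o (fine \o h) = h by apply/funext => x /=; rewrite fineK.
have hF x : a <= x <= b -> v x - v a = (\int[mu]_(t in `]a, x]) (fine \o h) t)%R.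
  move=> /andP[ax xb]; rewrite /Rintegral.
  under eq_integral do rewrite /= fineK//.
  rewrite -hE; last exact: measurable_itv.
  rewrite [nu _](_ : _ = lebesgue_stieltjes_measure V `]a, x]%classic).
    by rewrite stieltjes_itv_oc.
  rewrite /nu /= /mfrestr /mrestr setIidl//.
  by apply: subset_itvl; rewrite bnd_simp.
exists (fine \o h); split => //; first by rewrite EFinh.
have hset A : measurable A -> mu.-integrable A (EFin \o (fine \o h)).
  by move=> mA; rewrite EFinh; exact: integrableS hint.
have hloc : locally_integrable [set: R] (fine \o h).
  by apply: open_integrable_locally; [exact: openT|exact: hset].
have hy y : mu.-integrable [set` Interval (BRight a) (BRight y)] (EFin \o (fine \o h)).
  by apply: hset; exact: measurable_itv.
have := @FTC1 R (fine \o h) (BRight a) hy hloc.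
apply: filterS; first exact: (ae_filter_ringOfSetsType mu).
move=> x H /andP[ax xb].
have [dF F'] := H ax.
have near_eq : \forall z \near x, v a + (\int[mu]_(t in `]a, z]) (fine \o h) t)%R = v z.
  near=> z; rewrite -hF ?subrKC//; apply/andP; split.
    by apply: ltW; near: z; exact: lt_nbhsr.
  by apply: ltW; near: z; exact: lt_nbhsl.
have dG : is_derive x 1
    (fun z => v a + (\int[mu]_(t in `]a, z]) (fine \o h) t)%R) ((fine \o h) x).
  rewrite -F' derive1E -[X in is_derive _ _ _ X]add0r.
  by apply: is_deriveD; exact/derivableP.
have dv : is_derive x 1 v ((fine \o h) x).
  exact: near_eq_is_derive dG.
by split; [exact: ex_derive|rewrite derive1E (@derive_val _ _ _ _ _ _ _ dv)].
Unshelve. all: by end_near. Qed.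

End DensityOfMonotone.

(** * Derivatives on a segment *)

Section SegmentDerivative.
Context {R : realType}.
Implicit Types (a b x y : R).

Lemma diff_quot_cvg_is_derive a b x (f : R -> R) l : a < x < b ->
  diff_quot f x y @[y --> within `[a, b] (x^')] --> l <-> is_derive x 1 f l.
Proof.
move=> /andP[ax xb]; split => [H|[df dfl]].
  have H' : (fun h => h^-1 *: ((f \o shift x) (h *: (1 : R)) - f x)) @ 0^' --> l.
    apply/cvgrPdist_lt => e e0; move/cvgrPdist_lt : H => /(_ _ e0)[d /= d0 H].
    exists (Num.min d (Num.min (x - a) (b - x))) => [|h]/=.
      by rewrite !lt_min d0 !subr_gt0 ax.
    rewrite sub0r normrN !lt_min => /andP[hd /andP[ha hb]] h0.
    have := H (h + x); rewrite /= /diff_quot /shift /= addrK => /(_ _ _ _).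
    rewrite [h *: 1]mulr1 [_^-1 *: _]mulrC; apply.
    - by rewrite opprD addrC subrK normrN.
    - by rewrite -subr_eq0 addrK.
    - rewrite in_itv/=; move: ha hb; rewrite !ltr_norml => /andP[? ?] /andP[? ?].
      apply/andP; split; lra.
  split; first by apply/cvg_ex; exists l.
  exact: cvg_lim H'.
have H : (fun h => h^-1 *: ((f \o shift x) (h *: (1 : R)) - f x)) @ 0^' --> l.
  by rewrite -dfl; exact: df.
apply/cvgrPdist_lt => e e0; move/cvgrPdist_lt : H => /(_ _ e0)[d /= d0 H].
exists d => //= y xyd yx _.
have := H (y - x); rewrite /= /diff_quot /shift /= [_ *: 1]mulr1 subrK.
rewrite [_^-1 *: _]mulrC; apply; first by rewrite sub0r normrN distrC.
by rewrite subr_eq0.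
Qed.

(** Every point of a nondegenerate segment, endpoints included, is a limit of
    other points of it, so that limits along this filter are unique. *)
Lemma within_dnbhs_proper a b x : a < b -> a <= x <= b ->
  ProperFilter (within `[a, b] (x^')).
Proof.
move=> ab /andP[ax xb]; apply: Build_ProperFilter_ex => P [d /= d0 H].
have [xb'|bx] := ltP x b.
  exists (x + Num.min (d / 2) (b - x)); set m := Num.min _ _.
  have m0 : 0 < m by rewrite lt_min subr_gt0 xb' divr_gt0.
  have md : m <= d / 2 by rewrite ge_min lexx.
  have mb : m <= b - x by rewrite ge_min lexx orbT.
  apply: H => /=.
  - by rewrite opprD addNKr normrN gtr0_norm//; lra.
  - by rewrite -subr_eq0 addrC addKr gt_eqF.
  - rewrite in_itv/=; apply/andP; split; lra.
exists (x - Num.min (d / 2) (b - a)); set m := Num.min _ _.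
have m0 : 0 < m by rewrite lt_min subr_gt0 ab divr_gt0.
have md : m <= d / 2 by rewrite ge_min lexx.
have mb : m <= b - a by rewrite ge_min lexx orbT.
apply: H => /=.
- by rewrite opprD addNKr opprK gtr0_norm//; lra.
- by rewrite -subr_eq0 addrC addKr oppr_eq0 gt_eqF.
- rewrite in_itv/=; apply/andP; split; lra.
Qed.

Lemma derive_segE a b x (f : R -> R) l : a < x < b ->
  is_derive x 1 f l -> derive_seg a b f x = l.
Proof.
move=> axb /(diff_quot_cvg_is_derive f l axb).
have [ax xb] := andP axb.
apply: cvg_lim => //.
by apply: within_dnbhs_proper; [exact: lt_trans ax xb|rewrite !ltW].
Qed.

Lemma derivable_seg_is_derive a b x (f : R -> R) : a < x < b ->
  derivable_seg a b f x -> is_derive x 1 f (derive_seg a b f x).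
Proof. by move=> axb dfx; apply/(diff_quot_cvg_is_derive _ _ axb). Qed.

Lemma derivable_seg_continuous a b (f : R -> R) : a < b ->
  (forall x, x \in `[a, b] -> derivable_seg a b f x) ->
  {within `[a, b], continuous f}.
Proof.
move=> ab df; apply/subspace_continuousP => x xab.
have dfx := df _ xab.
have pf : ProperFilter (within `[a, b] (x^')) by apply: within_dnbhs_proper.
have H : (diff_quot f x y * (y - x) + f x) @[y --> within `[a, b] (x^')] -->
    derive_seg a b f x * (x - x) + f x.
  apply: cvgD; last exact: cvg_cst.
  apply: cvgM => //; apply: cvgB; last exact: cvg_cst.
  move=> A [d d0 dA]; exists d => // y xyd _ _; exact: dA.
move: H; rewrite subrr mulr0 add0r => H.
apply/cvgrPdist_lt => e e0; move/cvgrPdist_lt : H => /(_ _ e0)[d /= d0 H].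
exists d => //= y xyd yab; have [->|yx] := eqVneq y x.
  by rewrite subrr normr0.
by have := H y xyd yx yab; rewrite /diff_quot divfK ?subrK// subr_eq0.
Qed.

End SegmentDerivative.

(** * The fundamental theorem of calculus for absolutely continuous functions *)

Section SlopeBounds.
Context {R : realType}.
Implicit Types (a b x y : R).
Local Notation mu := (@lebesgue_measure R).

(** Almost everywhere u agrees with its absolute value, whose integral is
    nonnegative in the extended reals. *)
Lemma ae_Rintegral_ge0 (D : set (measurableTypeR R)) (u : R -> R) :
  measurable D -> measurable_fun D u -> {ae mu, forall t, D t -> 0 <= u t} ->
  0 <= (\int[mu]_(t in D) u t)%R.
Proof.
move=> mD muu u0; apply: fine_ge0.
rewrite (ae_eq_integral (fun t : measurableTypeR R => `|u t|%:E))//.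
- by apply: integral_ge0 => t _; rewrite lee_fin.
- exact/measurable_EFinP.
- by apply/measurable_EFinP; exact: measurableT_comp.
- have ? := ae_filter_ringOfSetsType mu; apply: filterS u0.
  move=> t ut Dt; by rewrite ger0_norm// ut.
Qed.

(** The density is the difference of those of the two monotone parts. That it
    equals derive_seg matters: derive_seg is 0 where there is no derivative,
    so a bound on its values does not imply that the derivative exists almost
    everywhere. *)
Lemma abs_continuous_increment a b (g : R -> R) x y :
  abs_continuous_seg a b g -> a <= x -> x < y -> y <= b ->
  exists h, [/\ mu.-integrable `]x, y] (EFin \o h),
    g y - g x = (\int[mu]_(t in `]x, y]) h t)%R &
    {ae mu, forall t, x < t < y -> h t = derive_seg a b g t}].
Proof.
move=> acg ax xy yb; have ab : a <= b by lra.
pose G := g \o clamp a b.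
have GE t : a <= t <= b -> G t = g t by move=> tab; rewrite /G/= clamp_id.
have acG : abs_continuousR G by exact: clamp_abs_continuous.
pose v := tv_from a G; pose w t := v t - G t.
have acv : abs_continuousR v by exact: tv_from_abs_continuous.
have acw : abs_continuousR w by exact: abs_continuousRB.
have Gmax t : G (Num.max a t) = G t by rewrite /G/= /clamp maxA maxxx.
have [hv [iv vE dv]] := nondecreasing_density (ltW xy) acv (tv_from_nondecreasing a acG).
have [hw [iw wE dw]] :=
  nondecreasing_density (ltW xy) acw (tv_fromB_nondecreasing acG Gmax).
have sub h : mu.-integrable setT (EFin \o h) -> mu.-integrable `]x, y] (EFin \o h).
  by move=> ih; apply: integrableS ih => //; exact: measurable_itv.
exists (fun t => hv t - hw t); split.
- rewrite (_ : EFin \o _ = (EFin \o hv) \- (EFin \o hw))%E; last by apply/funext.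
  by apply: integrableB; [exact: measurable_itv|exact: sub|exact: sub].
- rewrite RintegralB; [|exact: measurable_itv|exact: sub|exact: sub].
  have xyy : x <= y <= y by rewrite ltW//=.
  rewrite -(vE _ xyy) -(wE _ xyy).
  rewrite -!GE; [rewrite /w; lra|lra|lra].
- have ? := ae_filter_ringOfSetsType mu; move: dw; apply: filterS2 dv => t dvt dwt xty.
  have [dv dv'] := dvt xty; have [dw dw'] := dwt xty; apply/esym.
  have atb : a < t < b by lra.
  apply: (derive_segE atb).
  apply: (@near_eq_is_derive _ _ _ (fun s => v s - w s)).
    near=> s; rewrite /w subKr GE//; apply/andP; split; apply: ltW.
      by near: s; apply: lt_nbhsr; case/andP: atb.
    by near: s; apply: lt_nbhsl; case/andP: atb.
  rewrite -dv' -dw' !derive1E.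
  exact: (is_deriveB (derivableP dv) (derivableP dw)).
Unshelve. all: by end_near. Qed.

(** The bounds on the derivative, integrated: this is the form in which they
    enter the quadrature estimates. *)
Lemma abs_continuous_slope_bounds a b (g : R -> R) m M :
  abs_continuous_seg a b g ->
  {ae mu, forall t, t \in `[a, b] -> m <= derive_seg a b g t <= M} ->
  forall x y, a <= x -> x <= y -> y <= b ->
    m * (y - x) <= g y - g x <= M * (y - x).
Proof.
move=> acg bnd x y ax xy yb; have ? := ae_filter_ringOfSetsType mu.
move: xy; rewrite le_eqVlt => /predU1P[->|xy]; first by rewrite !subrr !mulr0 lexx.
have [h [ih -> hE]] := abs_continuous_increment acg ax xy yb.
have mD : measurable (`]x, y]%classic : set (measurableTypeR R)) by exact: measurable_itv.
have muD : mu `]x, y]%classic = (y - x)%:E by rewrite lebesgue_measure_itv/= lte_fin xy.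
have cstE c : (\int[mu]_(t in `]x, y]) cst c t)%R = c * (y - x).
  rewrite (Rintegral_cst mu mD c); congr (_ * _); exact: (congr1 fine muD).
have icst c : mu.-integrable `]x, y] (EFin \o cst c).
  apply: measurable_bounded_integrable => //.
    by rewrite [ltLHS]muD ltry.
  exists `|c|; split; first exact: num_real.
  by move=> z cz t _ /=; exact: ltW.
have hbnd : {ae mu, forall t, `]x, y]%classic t -> m <= h t <= M}.
  have y0 : {ae mu, forall t, t != y}.
    exists [set y]; split; [exact: measurable_set1|exact: lebesgue_measure_set1|].
    by move=> t /negP; rewrite negbK => /eqP.
  apply: filterS3 hE bnd y0 => t ht bt ty; rewrite /= in_itv/= => /andP[xt].
  rewrite le_eqVlt (negbTE ty)/= => tl; rewrite ht ?xt//; apply: bt.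
  by rewrite in_itv/=; apply/andP; split; lra.
have /measurable_EFinP mh := measurable_int _ ih.
rewrite -!cstE -subr_ge0 -[X in _ && X]subr_ge0 -!RintegralB//.
apply/andP; split; apply: ae_Rintegral_ge0 => //.
- by apply: measurable_funB.
- by apply: filterS hbnd => t ht /ht; rewrite subr_ge0 => /andP[].
- by apply: measurable_funB.
- by apply: filterS hbnd => t ht /ht; rewrite subr_ge0 => /andP[].
Qed.

End SlopeBounds.

(** * Integration by parts against a parabolic kernel *)

Section ParabolicKernel.
Context {R : realType}.
Implicit Types (a b p q s d t : R) (F f g : R -> R).

Definition two_antiderivatives a b F f g :=
  [/\ {within `[a, b], continuous F}, {within `[a, b], continuous f} &
   forall t, a < t < b -> is_derive t 1 F (f t) /\ is_derive t 1 f (g t)].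

Definition nondecreasing_on a b g :=
  forall x y, a <= x -> x <= y -> y <= b -> g x <= g y.

(** The Peano kernel on one half of the segment: s is its vertex, s - d and
    s + d are its zeros. *)
Definition kernel s d t := ((t - s) ^+ 2 - d ^+ 2) / 2.

(** The increment of this function over an interval is the Stieltjes integral
    of the kernel against g, integrated by parts twice; in this form it makes
    sense without a derivative of g. *)
Definition parts s d F f g t := F t - (t - s) * f t + kernel s d t * g t.

(** An antiderivative of the kernel; equal values at p and q mean that the
    kernel has mean zero on [p, q]. *)
Definition kernel_primitive s d t := (t - s) ^+ 3 / 6 - d ^+ 2 * t / 2.

Lemma two_antiderivativesW a b p q F f g : a <= p -> q <= b ->
  two_antiderivatives a b F f g -> two_antiderivatives p q F f g.
Proof.
move=> ap qb [cF cf dFf].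
have pqab : `[p, q] `<=` `[a, b] by apply: subset_itv; rewrite bnd_simp.
split; [exact: continuous_subspaceW cF|exact: continuous_subspaceW cf|].
by move=> t tpq; apply: dFf; lra.
Qed.

Lemma within_continuous_affine a b (h k : R -> R) l : {within `[a, b], continuous h} ->
  continuous k -> {within `[a, b], continuous (fun t => l * h t + k t)}.
Proof.
move=> ch /continuous_subspaceT ck x; apply: cvgD; last exact: ck.
by apply: cvgM; [exact: cvg_cst|exact: ch].
Qed.

Lemma within_continuousM a b (h k : R -> R) : {within `[a, b], continuous h} ->
  continuous k -> {within `[a, b], continuous (fun t => k t * h t)}.
Proof.
by move=> ch /continuous_subspaceT ck x; apply: cvgM; [exact: ck|exact: ch].
Qed.

Lemma two_antiderivatives_affine a b F f g l k : two_antiderivatives a b F f g ->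
  two_antiderivatives a b (fun t => k * F t + l * (t ^+ 3 / 6))
    (fun t => k * f t + l * (t ^+ 2 / 2)) (fun t => k * g t + l * t).
Proof.
move=> [cF cf dFf]; split.
- apply: within_continuous_affine => // x; apply: cvgM; first exact: cvg_cst.
  by apply: cvgM; [exact: exprn_continuous|exact: cvg_cst].
- apply: within_continuous_affine => // x; apply: cvgM; first exact: cvg_cst.
  by apply: cvgM; [exact: exprn_continuous|exact: cvg_cst].
- move=> t /dFf[dF df]; have dt := is_derive_id t (1 : R); split.
    rewrite (_ : (fun _ => _) = k *: F + (l / 6) *: (@idfun R) ^+ 3); last first.
      by apply/funext => u /=; rewrite !fctE /= /GRing.scale/=; field.
    apply: (is_derive_eq (is_deriveD (is_deriveZ k dF)
      (is_deriveZ (l / 6) (is_deriveX 3 dt)))).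
    by rewrite /GRing.scale/=; field.
  rewrite (_ : (fun _ => _) = k *: f + (l / 2) *: (@idfun R) ^+ 2); last first.
    by apply/funext => u /=; rewrite !fctE /= /GRing.scale/=; field.
  apply: (is_derive_eq (is_deriveD (is_deriveZ k df)
    (is_deriveZ (l / 2) (is_deriveX 2 dt)))).
  by rewrite /GRing.scale/=; field.
Qed.

(** Adding l * t to g adds l times the integral of the kernel to the
    increments of parts; the constant s ^+ 3 / 6 cancels in them. *)
Lemma parts_affine s d F f g l k t :
  parts s d (fun t => k * F t + l * (t ^+ 3 / 6))
    (fun t => k * f t + l * (t ^+ 2 / 2)) (fun t => k * g t + l * t) t =
  k * parts s d F f g t + l * (kernel_primitive s d t + s ^+ 3 / 6).
Proof. by rewrite /parts /kernel_primitive /kernel; field. Qed.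

(** The function parts with the factor g t of the kernel frozen at the value c.
    Its derivative (t - s) * (c - g t) has a constant sign on each side of s
    when c is an extreme value of g. *)
Definition anchored s d F f c t := F t - (t - s) * f t + c * kernel s d t.

Lemma anchored_derive a b s d F f g c t : two_antiderivatives a b F f g ->
  a < t < b -> is_derive t 1 (anchored s d F f c) ((t - s) * (c - g t)).
Proof.
move=> [_ _ dFf] /dFf[dF df]; rewrite /anchored /kernel.
rewrite (_ : (fun _ => _) = F - (idfun - cst s) * f +
    (c / 2) *: ((idfun - cst s) ^+ 2 - cst (d ^+ 2))); last first.
  by apply/funext => u /=; rewrite !fctE /= /GRing.scale/=; field.
have dts : is_derive t 1 ((@idfun R) - cst s) (1 - 0).
  exact: (is_deriveB (is_derive_id t 1) (is_derive_cst s t 1)).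
have dk : is_derive t 1 ((idfun - cst s) ^+ 2 - cst (d ^+ 2)) (2 * (t - s)).
  apply: (is_derive_eq (is_deriveB (is_deriveX 2 dts) (is_derive_cst _ _ _))).
  by rewrite !fctE /GRing.scale/=; ring.
apply: (is_derive_eq
  (is_deriveD (is_deriveB dF (is_deriveM dts df)) (is_deriveZ (c / 2) dk))).
by rewrite !fctE /GRing.scale/=; field.
Qed.

Lemma anchored_continuous a b s d F f g c : two_antiderivatives a b F f g ->
  {within `[a, b], continuous (anchored s d F f c)}.
Proof.
move=> [cF cf _].
have cs : continuous (fun t => t - s).
  by move=> x; apply: cvgB; [exact: cvg_id|exact: cvg_cst].
have ck : continuous (fun t => c * kernel s d t).
  move=> x; apply: cvgM; first exact: cvg_cst.
  apply: cvgM; last exact: cvg_cst.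
  apply: cvgB; last exact: cvg_cst.
  by under eq_fun do rewrite expr2; apply: cvgM; exact: cs.
have /continuous_subspaceT ck' := ck.
have cm := within_continuousM cf cs.
by move=> x; apply: cvgD; [apply: cvgB; [exact: cF|exact: cm]|exact: ck'].
Qed.

Lemma anchored_nondecreasing a b s d F f g c : two_antiderivatives a b F f g ->
  a <= b -> (forall t, a < t < b -> 0 <= (t - s) * (c - g t)) ->
  anchored s d F f c a <= anchored s d F f c b.
Proof.
move=> H ab pos.
apply: (@ger0_derive1_le_cc _ (anchored s d F f c) a b) => //.
- by move=> t; rewrite in_itv/= => /(anchored_derive s d c H) h; exact: ex_derive.
- move=> t; rewrite in_itv/= => tab; rewrite derive1E.
  have h := anchored_derive s d c H tab.
  by rewrite derive_val; exact: pos.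
- exact: anchored_continuous H.
- by rewrite in_itv/= lexx.
- by rewrite in_itv/= lexx ab.
Qed.

Lemma anchored_nonincreasing a b s d F f g c : two_antiderivatives a b F f g ->
  a <= b -> (forall t, a < t < b -> (t - s) * (c - g t) <= 0) ->
  anchored s d F f c b <= anchored s d F f c a.
Proof.
move=> H ab neg.
apply: (@ler0_derive1_le_cc _ (anchored s d F f c) a b) => //.
- by move=> t; rewrite in_itv/= => /(anchored_derive s d c H) h; exact: ex_derive.
- move=> t; rewrite in_itv/= => tab; rewrite derive1E.
  have h := anchored_derive s d c H tab.
  by rewrite derive_val; exact: neg.
- exact: anchored_continuous H.
- by rewrite in_itv/= lexx ab.
- by rewrite in_itv/= lexx ab.
Qed.

(** To the right of s the kernel increases, so its integral against the
    positive measure dg lies between its extreme values times the mass of dg.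
    Each inequality compares g with its value at one end of [p, q]. *)
Lemma parts_increasing_kernel p q s d F f g : two_antiderivatives p q F f g ->
  nondecreasing_on p q g -> p <= q -> s <= p ->
  kernel s d p * (g q - g p) <= parts s d F f g q - parts s d F f g p
    <= kernel s d q * (g q - g p).
Proof.
move=> H ndg pq sp.
have h1 := anchored_nondecreasing (s := s) (c := g q) d H pq.
have h2 := anchored_nonincreasing (s := s) (c := g p) d H pq.
have {}h1 : anchored s d F f (g q) p <= anchored s d F f (g q) q.
  apply: h1 => t /andP[pt tq]; have := ndg t q (ltW pt) (ltW tq) (lexx q).
  by move=> gt; rewrite mulr_ge0//; lra.
have {}h2 : anchored s d F f (g p) q <= anchored s d F f (g p) p.
  apply: h2 => t /andP[pt tq]; have := ndg p t (lexx p) (ltW pt) (ltW tq).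
  by move=> gt; rewrite mulr_ge0_le0//; lra.
move: h1 h2; rewrite /anchored /parts => h1 h2; apply/andP; split; lra.
Qed.

Lemma parts_decreasing_kernel p q s d F f g : two_antiderivatives p q F f g ->
  nondecreasing_on p q g -> p <= q -> q <= s ->
  kernel s d q * (g q - g p) <= parts s d F f g q - parts s d F f g p
    <= kernel s d p * (g q - g p).
Proof.
move=> H ndg pq qs.
have h1 := anchored_nonincreasing (s := s) (c := g q) d H pq.
have h2 := anchored_nondecreasing (s := s) (c := g p) d H pq.
have {}h1 : anchored s d F f (g q) q <= anchored s d F f (g q) p.
  apply: h1 => t /andP[pt tq]; have := ndg t q (ltW pt) (ltW tq) (lexx q).
  by move=> gt; rewrite mulr_le0_ge0//; lra.
have {}h2 : anchored s d F f (g p) p <= anchored s d F f (g p) q.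
  apply: h2 => t /andP[pt tq]; have := ndg p t (lexx p) (ltW pt) (ltW tq).
  by move=> gt; rewrite mulr_le0//; lra.
move: h1 h2; rewrite /anchored /parts => h1 h2; apply/andP; split; lra.
Qed.

End ParabolicKernel.

(** * Estimates on one half of the segment *)

Section Half.
Context {R : realType}.
Implicit Types (a b p q s d t : R) (F f g : R -> R).

(** C bounds the absolute value of the kernel: its minimum is
    - d ^+ 2 / 2, at s, and its maximum is at an endpoint. *)
Lemma parts_monotone_bound p q s d C F f g :
  two_antiderivatives p q F f g -> nondecreasing_on p q g -> p <= s <= q ->
  kernel s d p <= C -> kernel s d q <= C -> d ^+ 2 / 2 <= C ->
  `|parts s d F f g q - parts s d F f g p| <= C * (g q - g p).
Proof.
move=> H ndg /andP[ps sq] Cp Cq Cd.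
have Hl := two_antiderivativesW (lexx p) sq H.
have Hr := two_antiderivativesW ps (lexx q) H.
have ndl : nondecreasing_on p s g by move=> x y *; apply: ndg => //; lra.
have ndr : nondecreasing_on s q g by move=> x y *; apply: ndg => //; lra.
have /andP[l1 l2] := parts_decreasing_kernel d Hl ndl ps (lexx s).
have /andP[r1 r2] := parts_increasing_kernel d Hr ndr sq (lexx s).
have gl : 0 <= g s - g p by rewrite subr_ge0; apply: ndg.
have gr : 0 <= g q - g s by rewrite subr_ge0; apply: ndg.
have Ks : kernel s d s = - (d ^+ 2 / 2) by rewrite /kernel; field.
rewrite Ks in l1 r1.
have b1 := ler_wpM2r gl Cp; have b2 := ler_wpM2r gr Cq.
have b3 := ler_wpM2r gl Cd; have b4 := ler_wpM2r gr Cd.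
rewrite ler_norml; apply/andP; split; lra.
Qed.

Section SlopeBounded.
Context {p q s d m M : R} {F f g : R -> R}.
Context (Ffg : two_antiderivatives p q F f g).
Context (slope : forall x y, p <= x -> x <= y -> y <= q ->
  m * (y - x) <= g y - g x <= M * (y - x)).

Let J := kernel_primitive s d.
Let W := parts s d F f g.

Let lower := two_antiderivatives_affine (- m) 1 Ffg.
Let upper := two_antiderivatives_affine M (-1) Ffg.

Let lower_nd : nondecreasing_on p q (fun t => 1 * g t + - m * t).
Proof. by move=> x y px xy yq; have := slope px xy yq; lra. Qed.

Let upper_nd : nondecreasing_on p q (fun t => - 1 * g t + M * t).
Proof. by move=> x y px xy yq; have := slope px xy yq; lra. Qed.

(** Since the kernel has mean zero, g may be replaced by the nondecreasing
    functions g t - m * t and M * t - g t, whose increments appear on the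
    right. *)
Lemma parts_bound_above_slope C : p <= s <= q -> J p = J q ->
  kernel s d p <= C -> kernel s d q <= C -> d ^+ 2 / 2 <= C ->
  `|W q - W p| <= C * (g q - g p - m * (q - p)) /\
  `|W q - W p| <= C * (M * (q - p) - (g q - g p)).
Proof.
move=> psq Jpq Cp Cq Cd; split.
  have := parts_monotone_bound lower lower_nd psq Cp Cq Cd.
  rewrite !parts_affine -/J -/W => h; apply: le_trans (le_trans h _); last lra.
  by rewrite Jpq; rewrite le_eqVlt; apply/orP; left; apply/eqP; congr `|_|; lra.
have := parts_monotone_bound upper upper_nd psq Cp Cq Cd.
rewrite !parts_affine -/J -/W => h; apply: le_trans (le_trans h _); last lra.
by rewrite Jpq -normrN; rewrite le_eqVlt; apply/orP; left; apply/eqP; congr `|_|; lra.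
Qed.

(* With a zero of the kernel at the proper end, the monotone estimates applied
   to g t - m * t and M * t - g t say that these have nonnegative integrals
   against the kernel. *)
Let increment_nonneg_kernel x y : p <= x -> x <= y -> y <= q ->
  (s <= x /\ kernel s d x = 0) \/ (y <= s /\ kernel s d y = 0) ->
  m * (J y - J x) <= W y - W x <= M * (J y - J x).
Proof.
move=> px xy yq side.
have sub h : nondecreasing_on p q h -> nondecreasing_on x y h.
  by move=> ndh u v *; apply: ndh; lra.
have Hl := two_antiderivativesW px yq lower.
have Hu := two_antiderivativesW px yq upper.
case: side => -[sxy K0].
  have /andP[l _] := parts_increasing_kernel d Hl (sub _ lower_nd) xy sxy.
  have /andP[u _] := parts_increasing_kernel d Hu (sub _ upper_nd) xy sxy.
  by move: l u; rewrite K0 !parts_affine -/J -/W; lra.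
have /andP[l _] := parts_decreasing_kernel d Hl (sub _ lower_nd) xy sxy.
have /andP[u _] := parts_decreasing_kernel d Hu (sub _ upper_nd) xy sxy.
by move: l u; rewrite K0 !parts_affine -/J -/W; lra.
Qed.

Let increment_nonpos_kernel x y : p <= x -> x <= y -> y <= q ->
  (s <= x /\ kernel s d y = 0) \/ (y <= s /\ kernel s d x = 0) ->
  M * (J y - J x) <= W y - W x <= m * (J y - J x).
Proof.
move=> px xy yq side.
have sub h : nondecreasing_on p q h -> nondecreasing_on x y h.
  by move=> ndh u v *; apply: ndh; lra.
have Hl := two_antiderivativesW px yq lower.
have Hu := two_antiderivativesW px yq upper.
case: side => -[sxy K0].
  have /andP[_ l] := parts_increasing_kernel d Hl (sub _ lower_nd) xy sxy.
  have /andP[_ u] := parts_increasing_kernel d Hu (sub _ upper_nd) xy sxy.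
  by move: l u; rewrite K0 !parts_affine -/J -/W; lra.
have /andP[_ l] := parts_decreasing_kernel d Hl (sub _ lower_nd) xy sxy.
have /andP[_ u] := parts_decreasing_kernel d Hu (sub _ upper_nd) xy sxy.
by move: l u; rewrite K0 !parts_affine -/J -/W; lra.
Qed.

(** The kernel is nonnegative outside ]s - d, s + d[ and nonpositive inside;
    as it has mean zero, its positive and negative parts both have integral
    2 / 3 * d ^+ 3. The four intervals cut out by its zeros and its vertex are
    those where both its sign and its direction of variation are constant. *)
Lemma parts_bound_slopes : 0 <= d -> p <= s - d -> s + d <= q -> J p = J q ->
  `|W q - W p| <= (M - m) * (2 / 3 * d ^+ 3).
Proof.
move=> d0 psd sdq Jpq.
have K1 : kernel s d (s - d) = 0 by rewrite /kernel; field.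
have K2 : kernel s d (s + d) = 0 by rewrite /kernel; field.
have JE : J (s - d) - J (s + d) = 2 / 3 * d ^+ 3.
  by rewrite /J /kernel_primitive; field.
have /andP[a1 b1] : m * (J (s - d) - J p) <= W (s - d) - W p <= M * (J (s - d) - J p).
  by apply: increment_nonneg_kernel => //; [lra|right; split => //; lra].
have /andP[a2 b2] : M * (J s - J (s - d)) <= W s - W (s - d) <= m * (J s - J (s - d)).
  by apply: increment_nonpos_kernel; [lra|lra|lra|right; split => //; lra].
have /andP[a3 b3] : M * (J (s + d) - J s) <= W (s + d) - W s <= m * (J (s + d) - J s).
  by apply: increment_nonpos_kernel; [lra|lra|lra|left; split => //; lra].
have /andP[a4 b4] : m * (J q - J (s + d)) <= W q - W (s + d) <= M * (J q - J (s + d)).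
  by apply: increment_nonneg_kernel => //; [lra|left; split => //; lra].
rewrite -JE ler_norml; apply/andP; split; rewrite Jpq in a1 b1; lra.
Qed.

End SlopeBounded.
End Half.

(** * The corrected quadrature rule *)

Lemma derivable_seg_two_antiderivatives (R : realType) (a b : R) (f : R -> R) :
  a < b -> (forall x : R, x \in `[a, b] -> derivable_seg a b f x) ->
  two_antiderivatives a b
    (fun x => \int[lebesgue_measure]_(t in `[a, x]) f t)%R f (derive_seg a b f).
Proof.
move=> ab df; have cf := derivable_seg_continuous ab df.
have intf : (@lebesgue_measure R).-integrable `[a, b] (EFin \o f).
  by apply: continuous_compact_integrable => //; exact: segment_compact.
split => //; first exact: (parameterized_integral_continuous (ltW ab) intf).
move=> t atb; have [at_ tb] := andP atb.
have dft : is_derive t 1 f (derive_seg a b f t).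
  by apply: derivable_seg_is_derive => //; apply: df; rewrite in_itv/= !ltW.
split => //.
have ct : {for t, continuous f}.
  by apply/differentiable_continuous/derivable1_diffP; exact: ex_derive.
have [dF F'] := continuous_FTC1_closed tb intf at_ ct.
by rewrite -F' derive1E; exact/derivableP.
Qed.

(** On [a, m] and [m, b] the kernels have vertices a + c and b - c, where c is
    the weight of an endpoint, and take equal values at m, so the terms with
    f' m cancel; the values at a and b give the correction P. *)
Lemma quadrature_parts (R : realType) (a b d : R) (f : R -> R)
  (F := fun x => (\int[lebesgue_measure]_(t in `[a, x]) f t)%R)
  (f' := derive_seg a b f) (c := Num.sqrt 2 / 8 * (b - a)) (m := (a + b) / 2) :
  d ^+ 2 = (11 - 6 * Num.sqrt 2) / 96 * (b - a) ^+ 2 ->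
  Q f a b - P f a b =
    (parts (a + c) d F f f' m - parts (a + c) d F f f' a) +
    (parts (b - c) d F f f' b - parts (b - c) d F f f' m).
Proof.
have w2 : Num.sqrt 2 ^+ 2 = 2 :> R by rewrite sqr_sqrtr.
have Fa : F a = 0 by rewrite /F set_itv1 Rintegral_set1.
rewrite /Q /P -/(F b) /parts Fa /kernel /c /m -/f'.
move: (Num.sqrt 2) w2 => w w2 ->.
apply/eqP; rewrite -subr_eq0; apply/eqP.
(* The two sides differ by a multiple of w ^+ 2 - 2, where w = sqrt 2. *)
rewrite [LHS](_ : _ = (w ^+ 2 - 2) * (- ((b - a) ^+ 2 / 128) * (f' b - f' a)));
  last by field.
by rewrite w2 subrr mul0r.
Qed.

Theorem theorem14 (R : realType) (a b : R) (f : R -> R) (gamma2 Gamma2 : R)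
  (f' := derive_seg a b f) (f'' := derive_seg a b f')
  (S1 := (f' b - f' a) / (b - a)) :
  a < b ->
  (forall x : R, x \in `[a, b] -> derivable_seg a b f x) ->
  abs_continuous_seg a b f' ->
  (@lebesgue_measure R).-integrable `]a, b[ (fun t => (f'' t)%:E) ->
  {ae @lebesgue_measure R, forall t : R,
     t \in `[a, b] -> gamma2 <= f'' t <= Gamma2} ->
  [/\ `|Q f a b - P f a b| <=
        (Gamma2 - gamma2) / 2
        * (5 / 96 * Num.sqrt 6 - 29 / 432 * Num.sqrt 3) * (b - a) ^+ 3,
      `|Q f a b - P f a b| <=
        (1 / 12 - Num.sqrt 2 / 32) * (S1 - gamma2) * (b - a) ^+ 3 &
      `|Q f a b - P f a b| <=
        (1 / 12 - Num.sqrt 2 / 32) * (Gamma2 - S1) * (b - a) ^+ 3].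
Proof.
move=> ab df acf' _ bnd.
have slope := abs_continuous_slope_bounds acf' bnd.
have H := derivable_seg_two_antiderivatives ab df.
rewrite -/f' in slope H.
set L := b - a in S1 *; have L0 : 0 < L by rewrite subr_gt0.
set m := (a + b) / 2.
have am : a <= m by rewrite /m; lra.
have mb : m <= b by rewrite /m; lra.
have mE : m = a + L / 2 by rewrite /m /L; field.
have bE : b = a + L by rewrite /L; lra.
have Hl := two_antiderivativesW (lexx a) mb H.
have Hr := two_antiderivativesW am (lexx b) H.
have slopel x y : a <= x -> x <= y -> y <= m ->
    gamma2 * (y - x) <= f' y - f' x <= Gamma2 * (y - x).
  by move=> *; apply: slope => //; lra.
have sloper x y : m <= x -> x <= y -> y <= b ->
    gamma2 * (y - x) <= f' y - f' x <= Gamma2 * (y - x).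
  by move=> *; apply: slope => //; lra.
have w2 : Num.sqrt 2 ^+ 2 = 2 :> R by rewrite sqr_sqrtr.
have z2 : Num.sqrt 3 ^+ 2 = 3 :> R by rewrite sqr_sqrtr.
have w0 : 0 <= Num.sqrt 2 :> R by exact: sqrtr_ge0.
have z0 : 0 <= Num.sqrt 3 :> R by exact: sqrtr_ge0.
have wz : Num.sqrt 6 = Num.sqrt 2 * Num.sqrt 3 :> R.
  by rewrite -sqrtrM// -natrM.
have QP d := @quadrature_parts R a b d f.
rewrite -/L -/m -/f' in QP.
rewrite wz; move: (Num.sqrt 2) (Num.sqrt 3) w2 z2 w0 z0 QP => w z w2 z2 w0 z0 QP.
have wlo : 4 / 3 <= w.
  by rewrite -(@ler_pXn2r _ 2) ?nnegrE// w2; lra.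
have whi : w <= 3 / 2.
  by rewrite -(@ler_pXn2r _ 2) ?nnegrE// w2; lra.
(* Here w = sqrt 2 and z = sqrt 3. The mean-zero condition on the kernel asks
   for k ^+ 2 = (11 - 6 * w) / 96, and 22 - 12 * w = (3 * w - 2) ^+ 2. *)
pose k := z * (3 * w - 2) / 24; pose d := k * L.
have k0 : 0 <= k by rewrite /k !mulr_ge0//; lra.
have k2 : k ^+ 2 = (11 - 6 * w) / 96.
  rewrite /k !exprMn z2 (_ : (3 * w - 2) ^+ 2 = 9 * w ^+ 2 - 12 * w + 4); last by ring.
  by rewrite w2; field.
have k3 : k ^+ 3 = (11 - 6 * w) / 96 * k by rewrite exprSr k2.
have d0 : 0 <= d by rewrite mulr_ge0// ltW.
have d2 : d ^+ 2 = (11 - 6 * w) / 96 * L ^+ 2 by rewrite /d exprMn k2.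
have {}QP := QP d d2; rewrite {}QP.
pose c := w / 8 * L.
have kc : k <= w / 8.
  rewrite -(@ler_pXn2r _ 2) ?nnegrE//; last lra.
  by rewrite k2 exprMn w2; lra.
have kc' : k <= 1 / 2 - w / 8.
  rewrite -(@ler_pXn2r _ 2) ?nnegrE//; last lra.
  rewrite k2 (_ : _ ^+ 2 = 1 / 4 - w / 8 + w ^+ 2 / 64); last by field.
  by rewrite w2; lra.
have dc : d <= c by rewrite ler_wpM2r// ltW.
have dc' : d <= L / 2 - c.
  by have := ler_wpM2r (ltW L0) kc'; rewrite /d /c; lra.
have L2 : 0 <= L ^+ 2 by rewrite sqr_ge0.
have c2 : c ^+ 2 = L ^+ 2 / 32 by rewrite /c !exprMn w2; field.
have e2 : (L / 2 - c) ^+ 2 = (9 - 4 * w) / 32 * L ^+ 2.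
  by rewrite sqrrB c2 /c; field.
(* Let x = L / 2 - c. As x ^+ 3 + c ^+ 3 = (x + c) * (x ^+ 2 - x * c + c ^+ 2),
   this says that the kernel has mean zero on each half. *)
have xc : (L / 2 - c) ^+ 2 - (L / 2 * c - c ^+ 2) + c ^+ 2 = 3 * d ^+ 2.
  by rewrite e2 c2 d2 /c; field.
have d2x : d ^+ 2 = ((L / 2 - c) ^+ 2 - (L / 2 * c - c ^+ 2) + c ^+ 2) / 3.
  by rewrite xc; field.
have Jl : kernel_primitive (a + c) d a = kernel_primitive (a + c) d m.
  by rewrite /kernel_primitive mE d2x; field.
have Jr : kernel_primitive (b - c) d m = kernel_primitive (b - c) d b.
  by rewrite /kernel_primitive mE bE d2x; field.
pose C := (1 / 12 - w / 32) * L ^+ 2.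
have Ka : kernel (a + c) d a <= C.
  rewrite /kernel d2 /C (_ : (_ - _) ^+ 2 = c ^+ 2); last by ring.
  by rewrite c2; nra.
have Kb : kernel (b - c) d b <= C.
  rewrite /kernel d2 /C (_ : (_ - _) ^+ 2 = c ^+ 2); last by ring.
  by rewrite c2; nra.
have Kml : kernel (a + c) d m <= C.
  rewrite /kernel d2 /C (_ : (_ - _) ^+ 2 = (L / 2 - c) ^+ 2); last by rewrite mE; ring.
  by rewrite e2; nra.
have Kmr : kernel (b - c) d m <= C.
  rewrite /kernel d2 /C (_ : (_ - _) ^+ 2 = (L / 2 - c) ^+ 2);
    last by rewrite mE bE; field.
  by rewrite e2; nra.
have Kd : d ^+ 2 / 2 <= C by rewrite d2 /C; nra.
have c0 : 0 <= c by exact: le_trans dc.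
have cL : c <= L / 2 by lra.
have amc : a <= a + c <= m by rewrite lerDl c0 mE lerD2l.
have mcb : m <= b - c <= b by rewrite gerBl c0 andbT mE {1}bE; lra.
have [l1 l2] := parts_bound_above_slope Hl slopel amc Jl Ka Kml Kd.
have [r1 r2] := parts_bound_above_slope Hr sloper mcb Jr Kmr Kb Kd.
have acd : a <= a + c - d by rewrite -addrA lerDl subr_ge0.
have cdm : a + c + d <= m by rewrite mE -addrA lerD2l -lerBrDl.
have mcd : m <= b - c - d by rewrite mE bE; move: dc'; clear; lra.
have cdb : b - c + d <= b by rewrite -addrA gerDl addrC subr_le0.
have l3 := parts_bound_slopes Hl slopel d0 acd cdm Jl.
have r3 := parts_bound_slopes Hr sloper d0 mcd cdb Jr.
have S1E : f' b - f' a = S1 * L by rewrite /S1 divfK// gt_eqF.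
split; apply: le_trans (ler_normD _ _) _.
- apply: le_trans (lerD l3 r3) _.
  rewrite le_eqVlt; apply/orP; left; apply/eqP.
  rewrite /d exprMn k3 /k.
  rewrite [LHS](_ : _ =
      (Gamma2 - gamma2) / 2 * L ^+ 3 * z / 864 * (45 * w - 22 - 18 * w ^+ 2)); last first.
    by field.
  by rewrite w2; field.
- apply: le_trans (lerD l1 r1) _; rewrite /C le_eqVlt; apply/orP; left; apply/eqP.
  rewrite -mulrDr [X in _ * X = _](_ : _ = (S1 - gamma2) * L); first by field.
  by rewrite mulrBl -S1E /L; ring.
- apply: le_trans (lerD l2 r2) _; rewrite /C le_eqVlt; apply/orP; left; apply/eqP.
  rewrite -mulrDr [X in _ * X = _](_ : _ = (Gamma2 - S1) * L); first by field.
  by rewrite mulrBl -S1E /L; ring.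
Qed.
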